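(* Let $G\subset \mathrm{GL}(n)$ be a matrix Lie group with Lie algebra $\mathfrak g\subset\mathbb R^{n\times n}$, and let $(g(t),\xi(t))\in G\times\mathfrak g$, $0\le t<\infty$, be an arbitrary trajectory of $\dot g=g\xi$. Assume: (1) $A(t)=F g(t)$ for all $t\ge 0$, where $F\in\mathbb R^{n\times n}$ is a constant invertible matrix; (2) $\xi_{\rm m}(t)=\xi(t)+b$ for all $t\ge0$, where $b\in\mathfrak g$ is constant; (3) there are constants $B_\xi>0$, $B_b>0$ with $\|\xi(t)\|\le B_\xi$ for all $t\ge 0$ and $\|b\|\le B_b$, and there are numbers $L_g>0$, $U_g>0$ with $L_g\le\sigma_{\min}(g(t))\le\sigma_{\max}(g(t))\le U_g$ for all $t\ge0$. Consider the observer with state $(\bar A,\bar b)\in\mathbb R^{n\times n}\times\mathfrak g$ given by $$\dot{\bar A}=\bar A\,\xi_{\rm m}-A\bar b+k_P(A-\bar A),\qquad \dot{\bar b}=-k_I\,\pi_{\mathfrak g}\big(A^{-1}(A-\bar A)\big),$$ and let $E_A=A-\bar A$, $e_b=b-\bar b$. Then for any $k_P>2B_\xi+B_b$ and $k_I>0$ there exist numbers $a>0$ and $C>0$ such that $$\|E_A(t)\|+\|e_b(t)\|\le C\big(\|E_A(0)\|+\|e_b(0)\|\big)e^{-at}$$ for all $t\ge0$ and all initial conditions $(\bar A(0),\bar b(0))\in\mathbb R^{n\times n}\times\mathfrak g$ (with $a$, $C$ not depending on the initial condition).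
   Context: $\mathrm{GL}(n)=\{A\in\mathbb R^{n\times n}\mid\det A\ne0\}$; the Lie algebra $\mathfrak g$ of $G$ is regarded as a Lie subalgebra of $\mathbb R^{n\times n}$ with the matrix commutator. $\langle A,B\rangle=\operatorname{tr}(A^TB)$ is the Euclidean inner product on $\mathbb R^{n\times n}$, and $\|A\|=\sqrt{\langle A,A\rangle}$ is the Frobenius norm. $\pi_{\mathfrak g}:\mathbb R^{n\times n}\to\mathfrak g$ is the orthogonal projection onto $\mathfrak g$ with respect to $\langle\cdot,\cdot\rangle$. $\sigma_{\min}(\cdot)$ and $\sigma_{\max}(\cdot)$ denote the minimum and maximum singular values. *)

(* Defs.v *)
From HB Require Import structures.
From mathcomp Require Import all_boot all_order all_algebra.
From mathcomp Require Import all_classical all_reals all_analysis.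

Set Implicit Arguments.
Unset Strict Implicit.
Unset Printing Implicit Defensive.

Import Order.TTheory GRing.Theory Num.Theory.
Import numFieldNormedType.Exports.

Local Open Scope classical_set_scope.
Local Open Scope ring_scope.

(* A closed subgroup of GL(n).  Closedness is relative to GL(n), not to the
   space of all matrices. *)
Definition matrix_Lie_group (R : realType) (n : nat) (G : set 'M[R]_n) : Prop :=
  [/\ forall A, G A -> A \in unitmx,
      G 1%:M,
      forall A B, G A -> G B -> G (A *m B),
      forall A, G A -> G (invmx A) &
      forall A, closure G A -> A \in unitmx -> G A].

(* The Lie algebra as the tangent space of G at the identity: the velocities
   at time 0 of the differentiable curves of G through the identity. *)
Definition Lie_algebra (R : realType) (n : nat) (G : set 'M[R]_n) :
    set 'M[R]_n :=
  [set X | exists c : R -> 'M[R]_n,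
     [/\ forall t, G (c t),
         forall t, derivable c t 1,
         c 0 = 1%:M &
         is_derive (0 : R) (1 : R) c X]].

Definition mxdot (R : realType) (n : nat) (A B : 'M[R]_n) : R :=
  \tr (A^T *m B).

(* The library norm `|A| on matrices is the max norm. *)
Definition frobenius (R : realType) (n : nat) (A : 'M[R]_n) : R :=
  Num.sqrt (mxdot A A).

(* The point P of S such that M - P is orthogonal to S; it exists and is
   unique when S is a linear subspace, and the default value 0 is then never
   used. *)
Definition orth_proj (R : realType) (n : nat) (S : set 'M[R]_n)
    (M : 'M[R]_n) : 'M[R]_n :=
  xget 0 [set P | S P /\ forall Y, S Y -> mxdot (M - P) Y = 0].

Definition singular_values (R : realType) (n : nat) (A : 'M[R]_n) : set R :=
  [set s | 0 <= s /\ eigenvalue (A^T *m A) (s ^+ 2)].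

(* For 0 < n the set of singular values is finite and nonempty, so that inf
   and sup are its minimum and maximum. *)
Definition sigma_min (R : realType) (n : nat) (A : 'M[R]_n) : R :=
  inf (singular_values A).

Definition sigma_max (R : realType) (n : nat) (A : 'M[R]_n) : R :=
  sup (singular_values A).

(* f has derivative v at t relative to the domain [0, +oo[: the usual two-sided
   derivative when 0 < t, the right derivative when t = 0.  The values of f at
   negative times are irrelevant. *)
Definition has_derivative_nneg (R : realType) (n : nat) (f : R -> 'M[R]_n)
    (t : R) (v : 'M[R]_n) : Prop :=
  (fun h : R => h^-1 *: (f (t + h) - f t))
    @ within [set h : R | 0 <= t + h] (0 : R)^' --> v.

(* A trajectory, in G x g, of g' = g xi on [0, +oo[. *)
Definition is_trajectory (R : realType) (n : nat) (G : set 'M[R]_n)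
    (g xi : R -> 'M[R]_n) : Prop :=
  forall t : R, 0 <= t ->
    [/\ G (g t),
        Lie_algebra G (xi t) &
        has_derivative_nneg g t (g t *m xi t)].

(* A trajectory of the observer on [0, +oo[, with state (Abar, bbar) in the
   product of the space of all matrices and the Lie algebra of G. *)
Definition is_observer_trajectory (R : realType) (n : nat) (G : set 'M[R]_n)
    (kP kI : R) (A xim Abar bbar : R -> 'M[R]_n) : Prop :=
  forall t : R, 0 <= t ->
    [/\ Lie_algebra G (bbar t),
        has_derivative_nneg Abar t
          (Abar t *m xim t - A t *m bbar t + kP *: (A t - Abar t)) &
        has_derivative_nneg bbar t
          (- kI *: orth_proj (Lie_algebra G)
                     (invmx (A t) *m (A t - Abar t)))].

(* Main.v *)
Require Import Defs.
From mathcomp Require Import all_boot all_order all_algebra.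
From mathcomp Require Import all_classical all_reals all_analysis.
From mathcomp Require Import ring lra.

Import Order.TTheory GRing.Theory Num.Theory.
Import numFieldNormedType.Exports.

Local Open Scope classical_set_scope.
Local Open Scope ring_scope.

Set Implicit Arguments.
Unset Strict Implicit.
Unset Printing Implicit Defensive.

(** The error E = A - Abar is measured relative to A: with u = A^-1 E and
e = b - bbar, the derivative A' = A xi turns the observer into
  u' = - xi u + u (xi + b) - e - kP u,    e' = kI pi(u),
which no longer contains A ([relative_error_has_deriv]).  Since e lies in the
Lie algebra, <pi(u), e> = <u, e>, so that in the derivative of
|u|^2 / 2 + |e|^2 / (2 kI) the coupling terms between u and e cancel, and
Cauchy-Schwarz leaves at most - (kP - 2 Bxi - Bb) |u|^2.  This controls u only;
adding the cross term d <u, e> with a small d > 0 brings in - d |e|^2, because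
u' contains - e, while the new mixed terms are absorbed by the two negative
squares ([lyapunov_constants]).  The resulting W is equivalent to
|u|^2 + |e|^2 and satisfies W' <= - r W, hence decays exponentially
([exp_decay], [error_energy_decay]); r and the other constants depend on
neither the trajectory nor its initial value.

Two facts make this argument legitimate.  The Lie algebra, given as a set of
velocities of curves, is a linear subspace: products and reparametrizations of
curves in G add and rescale velocities ([Lie_algebra_lin_subspace]).  Therefore
the orthogonal projection onto it exists ([orth_projP]) and b - bbar stays in
it.  Finally u and E bound each other because A = F g and its inverse are
bounded, uniformly in time: the extreme values of the Rayleigh quotient of
g^T g are eigenvalues ([max_eigenvalue]), so the singular value bounds control
both g and g^-1 ([frobenius_sigma_max_le], [frobenius_sigma_min_le]). *)

(** * Limits of matrix-valued functions and difference quotients *)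

Lemma cvg_mx (K : realType) (T : Type) (F : set_system T) (FF : Filter F)
    (p q : nat) (f : T -> 'M[K]_(p, q)) (M : 'M[K]_(p, q)) :
  (forall i j, (fun x => f x i j) @ F --> M i j) -> f @ F --> M.
Proof.
move=> fM A [P MP PA].
have H (i : 'I_p) : \forall x \near F, forall j, P i j (f x i j).
  by apply: filter_forall => j; exact: (fM i j _ (MP i j)).
have := filter_forall FF H; apply: (@filterS _ F FF) => x Px.
by apply: PA => i j; exact: Px.
Qed.

Lemma cvg_coord (K : realType) (T : Type) (F : set_system T) (FF : Filter F)
    (p q : nat) (f : T -> 'M[K]_(p, q)) (M : 'M[K]_(p, q)) i j :
  f @ F --> M -> (fun x => f x i j) @ F --> M i j.
Proof.
move=> fM; apply: (cvg_comp f (fun N : 'M[K]_(p, q) => N i j) fM).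
exact: coord_continuous.
Qed.

Lemma cvg_sumR (K : realType) (T I : Type) (F : set_system T) (FF : Filter F)
    (r : seq I) (P : pred I) (f : I -> T -> K) (a : I -> K) :
  (forall i, P i -> f i @ F --> a i) ->
  (fun x => \sum_(i <- r | P i) f i x) @ F --> \sum_(i <- r | P i) a i.
Proof.
move=> fa; exact: (cvg_big (op := +%R) add_continuous).
Qed.

Lemma cvg_prodR (K : realType) (T I : Type) (F : set_system T) (FF : Filter F)
    (r : seq I) (P : pred I) (f : I -> T -> K) (a : I -> K) :
  (forall i, P i -> f i @ F --> a i) ->
  (fun x => \prod_(i <- r | P i) f i x) @ F --> \prod_(i <- r | P i) a i.
Proof.
move=> fa; exact: (@cvg_big K I *%R 1 P mul_continuous T F r f a FF fa).
Qed.

Lemma cvg_mulmx (K : realType) (T : Type) (F : set_system T) (FF : Filter F)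
    (p q r : nat) (f : T -> 'M[K]_(p, q)) (g : T -> 'M[K]_(q, r))
    (A : 'M[K]_(p, q)) (B : 'M[K]_(q, r)) :
  f @ F --> A -> g @ F --> B -> (fun x => f x *m g x) @ F --> A *m B.
Proof.
move=> fA gB; apply: cvg_mx => i j; rewrite mxE.
under eq_fun do rewrite mxE.
by apply: cvg_sumR => k _; apply: cvgM; exact: cvg_coord.
Qed.

Lemma cvg_trmx (K : realType) (T : Type) (F : set_system T) (FF : Filter F)
    (p q : nat) (f : T -> 'M[K]_(p, q)) (A : 'M[K]_(p, q)) :
  f @ F --> A -> (fun x => (f x)^T) @ F --> A^T.
Proof.
move=> fA; apply: cvg_mx => i j; rewrite mxE.
by under eq_fun do rewrite mxE; exact: cvg_coord.
Qed.

Lemma cvg_mxtrace (K : realType) (T : Type) (F : set_system T) (FF : Filter F)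
    (p : nat) (f : T -> 'M[K]_p) (A : 'M[K]_p) :
  f @ F --> A -> (fun x => \tr (f x)) @ F --> \tr A.
Proof. by move=> fA; apply: cvg_sumR => i _; exact: cvg_coord. Qed.

Lemma cvg_det (K : realType) (T : Type) (F : set_system T) (FF : Filter F)
    (p : nat) (f : T -> 'M[K]_p) (A : 'M[K]_p) :
  f @ F --> A -> (fun x => \det (f x)) @ F --> \det A.
Proof.
move=> fA; apply: cvg_sumR => s _; apply: cvgM; first exact: cvg_cst.
by apply: cvg_prodR => i _; exact: cvg_coord.
Qed.

Lemma cvg_adjugate (K : realType) (T : Type) (F : set_system T) (FF : Filter F)
    (p : nat) (f : T -> 'M[K]_p) (A : 'M[K]_p) :
  f @ F --> A -> (fun x => \adj (f x)) @ F --> \adj A.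
Proof.
move=> fA; apply: cvg_mx => i j; rewrite mxE.
under eq_fun do rewrite mxE.
apply: cvgM; first exact: cvg_cst.
apply: cvg_det; apply: cvg_mx => k l; rewrite !mxE.
by under eq_fun do rewrite !mxE; exact: cvg_coord.
Qed.

Lemma cvg_invmx (K : realType) (T : Type) (F : set_system T) (FF : Filter F)
    (p : nat) (f : T -> 'M[K]_p) (A : 'M[K]_p) :
  (forall x, f x \in unitmx) -> A \in unitmx ->
  f @ F --> A -> (fun x => invmx (f x)) @ F --> invmx A.
Proof.
move=> fU AU fA; rewrite /invmx AU; under eq_fun do rewrite fU.
apply: cvgZ; last exact: cvg_adjugate.
apply: cvgV; last exact: cvg_det.
by move: AU; rewrite unitmxE unitfE.
Qed.

(** The filter F of increments is a parameter: the punctured neighbourhoods of 0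
give the two-sided derivative, needed for curves in G, and [nneg_increments]
below the derivative relative to the half-line. *)
Definition has_deriv (K : realType) (V : normedModType K) (F : set_system K)
    (f : K -> V) (t : K) (v : V) : Prop :=
  (fun h : K => h^-1 *: (f (t + h) - f t)) @ F --> v.

Section has_deriv_theory.
Variables (K : realType) (F : set_system K).
Hypotheses (FF : Filter F) (F0 : F --> (0 : K)^').

Let Fid : (fun h : K => h) @ F --> (0 : K).
Proof. by apply: cvg_trans F0 _; exact: cvg_within. Qed.

Let Fneq0 : \forall h \near F, h != 0.
Proof. exact: (F0 (@nbhs_dnbhs_neq K 0)). Qed.

Lemma has_deriv_cvg (V : normedModType K) (f : K -> V) t v :
  has_deriv F f t v -> (fun h => f (t + h)) @ F --> f t.
Proof.
move=> fv.
have : (fun h : K => h *: (h^-1 *: (f (t + h) - f t)) + f t) @ F --> 0 *: v + f t.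
  by apply: cvgD; [exact: cvgZ | exact: cvg_cst].
rewrite scale0r add0r; apply: cvg_trans; apply: near_eq_cvg.
near=> h; rewrite scalerA mulfV ?scale1r ?subrK //; near: h; exact: Fneq0.
Unshelve. all: by end_near. Qed.

Lemma has_deriv_cst (V : normedModType K) (a : V) t : has_deriv F (fun=> a) t 0.
Proof.
by rewrite /has_deriv; under eq_fun do rewrite subrr scaler0; exact: cvg_cst.
Qed.

Lemma has_derivD (V : normedModType K) (f g : K -> V) t v w :
  has_deriv F f t v -> has_deriv F g t w ->
  has_deriv F (fun s => f s + g s) t (v + w).
Proof.
move=> fv gw; rewrite /has_deriv.
under eq_fun do rewrite opprD addrACA scalerDr.
exact: cvgD.
Qed.

Lemma has_derivZ (V : normedModType K) (f : K -> V) k t v :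
  has_deriv F f t v -> has_deriv F (fun s => k *: f s) t (k *: v).
Proof.
move=> fv; rewrite /has_deriv.
under eq_fun do rewrite -scalerBr scalerA mulrC -scalerA.
by apply: cvgZ => //; exact: cvg_cst.
Qed.

Lemma has_derivB (V : normedModType K) (f g : K -> V) t v w :
  has_deriv F f t v -> has_deriv F g t w ->
  has_deriv F (fun s => f s - g s) t (v - w).
Proof.
move=> fv gw; rewrite /has_deriv.
under eq_fun do rewrite opprD addrACA -opprD scalerBr.
exact: cvgB.
Qed.

(** One product rule for every product in use, from
B(f', g') - B(f, g) = B(f' - f, g') + B(f, g' - g).  The hypothesis Bcvg stands
for joint continuity of B. *)
Lemma has_deriv_bilinear (U V W : normedModType K) (B : U -> V -> W)
    (BBl : forall a a' b, B (a - a') b = B a b - B a' b)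
    (BBr : forall a b b', B a (b - b') = B a b - B a b')
    (BZl : forall k a b, B (k *: a) b = k *: B a b)
    (BZr : forall k a b, B a (k *: b) = k *: B a b)
    (Bcvg : forall (f : K -> U) (g : K -> V) a b,
      f @ F --> a -> g @ F --> b -> (fun h => B (f h) (g h)) @ F --> B a b)
    (f : K -> U) (g : K -> V) t v w :
  has_deriv F f t v -> has_deriv F g t w ->
  has_deriv F (fun s => B (f s) (g s)) t (B v (g t) + B (f t) w).
Proof.
move=> fv gw; rewrite /has_deriv.
under eq_fun => h do rewrite -(subrKA (B (f t) (g (t + h)))) -BBl -BBr
  scalerDr -BZl -BZr.
apply: cvgD; apply: Bcvg => //; first exact: has_deriv_cvg gw.
exact: cvg_cst.
Qed.

Lemma has_deriv_mulmx (p q r : nat) (f : K -> 'M[K]_(p, q))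
    (g : K -> 'M[K]_(q, r)) t v w :
  has_deriv F f t v -> has_deriv F g t w ->
  has_deriv F (fun s => f s *m g s) t (v *m g t + f t *m w).
Proof.
move=> fv gw.
apply: (has_deriv_bilinear (B := @mulmx K p q r) _ _ _ _ _ fv gw)
  => [a a' b|a b b'|k a b|k a b|f' g' a b].
- exact: mulmxBl.
- exact: mulmxBr.
- by rewrite scalemxAl.
- by rewrite scalemxAr.
- exact: cvg_mulmx.
Qed.

Lemma has_deriv_mxdot (p : nat) (f g : K -> 'M[K]_p) t v w :
  has_deriv F f t v -> has_deriv F g t w ->
  has_deriv F (fun s => mxdot (f s) (g s)) t (mxdot v (g t) + mxdot (f t) w).
Proof.
move=> fv gw.
apply: (has_deriv_bilinear (B := fun a b : 'M[K]_p => mxdot a b : K^o)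
  _ _ _ _ _ fv gw) => [a a' b|a b b'|k a b|k a b|f' g' a b]; rewrite /mxdot.
- by rewrite linearB /= mulmxBl linearB.
- by rewrite mulmxBr linearB.
- by rewrite linearZ /= -scalemxAl linearZ.
- by rewrite -scalemxAr linearZ.
- move=> fa gb; apply: cvg_mxtrace; apply: cvg_mulmx => //; exact: cvg_trmx.
Qed.

(** The difference of two inverses is
X^-1 - Y^-1 = - X^-1 (X - Y) Y^-1, and inversion is continuous on units by
Cramer's rule, so no derivative of the determinant is needed. *)
Lemma has_deriv_invmx (p : nat) (f : K -> 'M[K]_p) t v :
  (forall s, f s \in unitmx) -> has_deriv F f t v ->
  has_deriv F (fun s => invmx (f s)) t (- (invmx (f t) *m v *m invmx (f t))).
Proof.
move=> fU fv; rewrite /has_deriv.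
have -> : (fun h => h^-1 *: (invmx (f (t + h)) - invmx (f t))) =
  (fun h => (- invmx (f (t + h))) *m (h^-1 *: (f (t + h) - f t))
    *m invmx (f t)).
  apply/funext => h; rewrite -scalemxAr -scalemxAl; congr (_ *: _).
  rewrite mulmxBr !mulNmx mulVmx // opprK mulmxDl mulNmx mul1mx addrC.
  by rewrite mulmxK.
rewrite -!mulNmx; apply: cvg_mulmx; last exact: cvg_cst.
apply: cvg_mulmx => //; apply: cvgN; apply: cvg_invmx => //.
exact: has_deriv_cvg fv.
Qed.

End has_deriv_theory.

(** * One-sided derivatives and exponential decay on the half-line *)

(** With this filter [has_deriv] unfolds to [has_derivative_nneg]. *)
Definition nneg_increments (K : realType) (t : K) : set_system K :=
  within [set h : K | 0 <= t + h] (0 : K)^'.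

Lemma nneg_increments_filter (K : realType) (t : K) :
  Filter (nneg_increments t).
Proof. exact: within_filter. Qed.

Lemma nneg_increments_dnbhs (K : realType) (t : K) :
  nneg_increments t --> (0 : K)^'.
Proof. exact: cvg_within. Qed.

Lemma eq_has_deriv_nneg (K : realType) (V : normedModType K) (f g : K -> V) t v :
  0 <= t -> (forall s, 0 <= s -> f s = g s) ->
  has_deriv (nneg_increments t) f t v -> has_deriv (nneg_increments t) g t v.
Proof.
move=> t0 fg; apply: cvg_trans; apply: near_eq_cvg.
rewrite near_withinE; apply: nearW => h th.
by rewrite (fg t t0) (fg _ th).
Qed.

Lemma has_deriv_nneg_is_derive (K : realType) (V : normedModType K)
    (f : K -> V) (t : K) (v : V) :
  0 < t -> has_deriv (nneg_increments t) f t v -> is_derive t 1 f v.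
Proof.
move=> t0 fv.
have lim : (fun h => h^-1 *: (f (h *: 1 + t) - f t)) @ (0 : K)^' --> v.
  apply: (cvg_trans _ fv) => A fA.
  have tpos : \forall h \near (0 : K)^', 0 <= t + h.
    near=> h; have : `|h| < t by near: h; exact: dnbhs0_lt.
    by rewrite ltr_norml => /andP[]; lra.
  have fA' : \forall h \near (0 : K)^',
      0 <= t + h -> A (h^-1 *: (f (t + h) - f t)) by exact: fA.
  suff : \forall h \near (0 : K)^', A (h^-1 *: (f (h *: 1 + t) - f t)) by [].
  near=> h; rewrite [h *: 1]mulr1 [h + t]addrC.
  have th : 0 <= t + h by near: h.
  by move: th; near: h.
by split; [apply/cvg_ex; exists v | exact/cvg_lim].
Unshelve. all: by end_near. Qed.

Lemma has_deriv_nneg_cvg_right (K : realType) (f : K -> K) v :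
  has_deriv (nneg_increments 0) (f : K -> K^o) 0 v -> f @ 0^'+ --> f 0.
Proof.
move=> fv.
have := has_deriv_cvg (nneg_increments_filter 0) (@nneg_increments_dnbhs K 0) fv.
apply: cvg_trans => A fA.
have {}fA : \forall h \near (0 : K), h != 0 -> 0 <= 0 + h -> A (f (0 + h)).
  exact: fA.
suff : \forall h \near (0 : K), 0 < h -> A (f h) by [].
apply: filterS fA => h + h0.
by rewrite add0r; apply; [rewrite gt_eqF | exact: ltW].
Qed.

(** Gronwall's inequality: the derivative of w(t) exp(r t) is nonpositive for
t > 0.  At t = 0 only right continuity is known, which is what monotonicity on
the closed half-line requires. *)
Lemma exp_decay (K : realType) (w dw : K -> K) (r : K) :
  (forall t : K, 0 <= t -> has_deriv (nneg_increments t) (w : K -> K^o) t (dw t)) ->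
  (forall t : K, 0 <= t -> dw t <= - r * w t) ->
  forall t : K, 0 <= t -> w t <= w 0 * expR (- r * t).
Proof.
move=> w' dw_le t t0.
pose phi : K -> K := (fun s : K => expR (r * s)) * w.
have phi' (s : K) : 0 < s ->
    is_derive s (1 : K) phi (expR (r * s) * dw s + w s * (expR (r * s) * r)).
  move=> s0; have ws := has_deriv_nneg_is_derive s0 (w' s (ltW s0)).
  have er : is_derive s (1 : K) (fun s => expR (r * s)) (expR (r * s) * r).
    have rs : is_derive s (1 : K) (fun s => r * s) r.
      have := is_deriveZ r (is_derive_id s (1 : K)).
      by rewrite [r *: 1]mulr1.
    exact: is_derive1_comp.
  exact: is_deriveM.
have le0 : phi t <= phi 0.
  apply: (@ler0_derive1_nincry _ phi 0) => //.
  - by move=> s; rewrite in_itv /= andbT => /phi' [].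
  - move=> s; rewrite in_itv /= andbT => s0.
    rewrite derive1E; have [_ ->] := phi' s s0.
    rewrite mulrCA -mulrDr pmulr_rle0 ?expR_gt0 //.
    by have := dw_le s (ltW s0); rewrite mulNr mulrC; lra.
  - apply/continuous_within_itvcyP; split.
      move=> s; rewrite in_itv /= andbT => s0.
      have [ds _] := phi' s s0.
      exact/differentiable_continuous/derivable1_diffP.
    apply: cvgM; last exact: has_deriv_nneg_cvg_right (w' 0 (lexx 0)).
    apply: cvg_at_right_filter.
    have : continuous (fun s : K => expR (r * s)).
      move=> s; apply: continuous_comp; last exact: continuous_expR.
      exact: mulrl_continuous.
    exact.
move: le0; rewrite /phi /= [X in X <= _]/GRing.mul /= [X in _ <= X]/GRing.mul /=.
rewrite mulr0 expR0 mul1r mulNr expRN => le0.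
by rewrite ler_pdivlMr ?expR_gt0 // mulrC.
Qed.

(** * The Frobenius inner product *)

(** The form [mxdot] for rectangular matrices, so that rows and columns are
covered by the same theory. *)
Definition mxip (K : realType) (p q : nat) (A B : 'M[K]_(p, q)) : K :=
  \tr (A^T *m B).

Section mxip_theory.
Variable K : realType.
Implicit Types (p q r : nat).

Lemma mxipE p q (A B : 'M[K]_(p, q)) :
  mxip A B = \sum_i \sum_j A i j * B i j.
Proof.
rewrite /mxip /mxtrace exchange_big; apply: eq_bigr => j _.
by rewrite mxE; apply: eq_bigr => i _; rewrite mxE.
Qed.

Lemma mxipC p q (A B : 'M[K]_(p, q)) : mxip A B = mxip B A.
Proof. by rewrite /mxip -mxtrace_tr trmx_mul trmxK. Qed.

Lemma mxipDl p q (A B C : 'M[K]_(p, q)) : mxip (A + B) C = mxip A C + mxip B C.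
Proof. by rewrite /mxip linearD /= mulmxDl linearD. Qed.

Lemma mxipDr p q (A B C : 'M[K]_(p, q)) : mxip C (A + B) = mxip C A + mxip C B.
Proof. by rewrite /mxip mulmxDr linearD. Qed.

Lemma mxipZl p q k (A B : 'M[K]_(p, q)) : mxip (k *: A) B = k * mxip A B.
Proof. by rewrite /mxip linearZ /= -scalemxAl linearZ. Qed.

Lemma mxipZr p q k (A B : 'M[K]_(p, q)) : mxip A (k *: B) = k * mxip A B.
Proof. by rewrite mxipC mxipZl mxipC. Qed.

Lemma mxipNl p q (A B : 'M[K]_(p, q)) : mxip (- A) B = - mxip A B.
Proof. by rewrite -scaleN1r mxipZl mulN1r. Qed.

Lemma mxipNr p q (A B : 'M[K]_(p, q)) : mxip A (- B) = - mxip A B.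
Proof. by rewrite mxipC mxipNl mxipC. Qed.

Lemma mxipBl p q (A B C : 'M[K]_(p, q)) : mxip (A - B) C = mxip A C - mxip B C.
Proof. by rewrite mxipDl mxipNl. Qed.

Lemma mxipBr p q (A B C : 'M[K]_(p, q)) : mxip C (A - B) = mxip C A - mxip C B.
Proof. by rewrite mxipDr mxipNr. Qed.

Lemma mxip_suml p q k (c : 'I_k -> K) (u : 'I_k -> 'M[K]_(p, q)) B :
  mxip (\sum_(i < k) c i *: u i) B = \sum_(i < k) c i * mxip (u i) B.
Proof.
rewrite /mxip linear_sum mulmx_suml linear_sum; apply: eq_bigr => i _.
exact: mxipZl.
Qed.

Lemma mxip_ge0 p q (A : 'M[K]_(p, q)) : 0 <= mxip A A.
Proof.
rewrite mxipE; apply: sumr_ge0 => i _; apply: sumr_ge0 => j _.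
by rewrite -expr2 sqr_ge0.
Qed.

Lemma mxip_eq0 p q (A : 'M[K]_(p, q)) : (mxip A A == 0) = (A == 0).
Proof.
apply/eqP/eqP => [|->]; last by rewrite /mxip mulmx0 linear0.
have sq (x : K) : 0 <= x * x by rewrite -expr2 sqr_ge0.
rewrite mxipE => /psumr_eq0P A0; apply/matrixP => i j; rewrite mxE.
have /psumr_eq0P Ai0 : \sum_j A i j * A i j = 0.
  by apply: A0 => // k _; apply: sumr_ge0.
by apply/eqP; rewrite -sqrf_eq0 expr2; apply/eqP; apply: Ai0.
Qed.

(** Cauchy-Schwarz, from the nonnegative square of <B, B> A - <A, B> B. *)
Lemma mxip_sqr_le p q (A B : 'M[K]_(p, q)) :
  mxip A B ^+ 2 <= mxip A A * mxip B B.
Proof.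
have [->|B0] := eqVneq B 0.
  by rewrite /mxip !mulmx0 !linear0 expr0n mulr0.
have Bpos : 0 < mxip B B by rewrite lt_def mxip_eq0 B0 mxip_ge0.
have := mxip_ge0 (mxip B B *: A - mxip A B *: B).
rewrite !(mxipBl, mxipBr, mxipZl, mxipZr) (mxipC B A).
set a := mxip A A; set b := mxip B B; set c := mxip A B => H.
have {}H : 0 <= b * (a * b - c ^+ 2).
  by apply: le_trans H _; rewrite le_eqVlt; apply/orP; left; apply/eqP; ring.
by move: H; rewrite pmulr_rge0 // subr_ge0.
Qed.

(** Each entry of A B is an inner product of a row with a column, so
Cauchy-Schwarz applies entrywise and the bounds add up to a product of sums. *)
Lemma mxip_mulmx_le p q r (A : 'M[K]_(p, q)) (B : 'M[K]_(q, r)) :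
  mxip (A *m B) (A *m B) <= mxip A A * mxip B B.
Proof.
rewrite (mxipE A) (mxipE B) (mxipE (A *m B)) [X in _ * X]exchange_big /=.
rewrite big_distrlr /=; apply: ler_sum => i _; apply: ler_sum => j _.
have -> : (A *m B) i j = mxip (row i A)^T (col j B).
  rewrite mxE mxipE; apply: eq_bigr => k _.
  by rewrite big_ord1 !mxE.
have rowE : mxip (row i A)^T (row i A)^T = \sum_k A i k * A i k.
  by rewrite mxipE; apply: eq_bigr => k _; rewrite big_ord1 !mxE.
have colE : mxip (col j B) (col j B) = \sum_k B k j * B k j.
  by rewrite mxipE; apply: eq_bigr => k _; rewrite big_ord1 !mxE.
by rewrite -rowE -colE -expr2 mxip_sqr_le.
Qed.

Lemma mxip_tr p q (A : 'M[K]_(p, q)) : mxip A^T A^T = mxip A A.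
Proof. by rewrite /mxip trmxK mxtrace_mulC. Qed.

Lemma sqr_coord_le p q (A : 'M[K]_(p, q)) i j : A i j ^+ 2 <= mxip A A.
Proof.
have sq (x : K) : 0 <= x * x by rewrite -expr2 sqr_ge0.
rewrite mxipE (bigD1 i) //= (bigD1 j) //= -expr2 -addrA lerDl.
by rewrite addr_ge0 // !sumr_ge0 // => k _; apply: sumr_ge0.
Qed.


Lemma frobenius_ge0 p (A : 'M[K]_p) : 0 <= frobenius A.
Proof. exact: sqrtr_ge0. Qed.

Lemma sqr_frobenius p (A : 'M[K]_p) : frobenius A ^+ 2 = mxip A A.
Proof. by rewrite /frobenius sqr_sqrtr // mxip_ge0. Qed.

Lemma mxip_le p (A B : 'M[K]_p) : `|mxip A B| <= frobenius A * frobenius B.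
Proof.
rewrite -(@ler_pXn2r _ 2) ?nnegrE ?mulr_ge0 ?frobenius_ge0 //.
by rewrite real_normK ?num_real // exprMn !sqr_frobenius mxip_sqr_le.
Qed.

Lemma frobenius_mulmx p (A B : 'M[K]_p) :
  frobenius (A *m B) <= frobenius A * frobenius B.
Proof.
rewrite -(@ler_pXn2r _ 2) ?nnegrE ?mulr_ge0 ?frobenius_ge0 //.
by rewrite exprMn !sqr_frobenius mxip_mulmx_le.
Qed.

Lemma mxip_mulmx_abs p (P Q S : 'M[K]_p) :
  `|mxip P (Q *m S)| <= frobenius P * (frobenius Q * frobenius S).
Proof.
apply: le_trans (mxip_le _ _) _; apply: ler_wpM2l; first exact: frobenius_ge0.
exact: frobenius_mulmx.
Qed.

End mxip_theory.

(** * Orthogonal projection onto a linear subspace *)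

Definition lin_subspace (K : realType) (n : nat) (S : set 'M[K]_n) : Prop :=
  [/\ S 0, forall A B, S A -> S B -> S (A + B) & forall k A, S A -> S (k *: A)].

Section orthogonal_projection.
Variables (K : realType) (n : nat) (S : set 'M[K]_n).
Hypothesis linS : lin_subspace S.

Definition orthonormal_in (k : nat) : Prop :=
  exists u : 'I_k -> 'M[K]_n, (forall i, S (u i)) /\
    (forall i j, mxip (u i) (u j) = (i == j)%:R).

Lemma orthonormal_in_le k : orthonormal_in k -> (k <= n * n)%N.
Proof.
move=> [u [_ uN]].
have /freeP : forall c : 'I_k -> K,
    \sum_(i < k) c i *: [tuple u i | i < k]`_i = 0 -> forall i, c i = 0.
  move=> c c0 i.
  have : mxip (\sum_(j < k) c j *: u j) (u i) = 0.
    suff -> : \sum_(j < k) c j *: u j = 0 by rewrite /mxip trmx0 mul0mx linear0.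
    rewrite -[RHS]c0; apply: eq_bigr => j _.
    by rewrite -tnth_nth tnth_mktuple.
  rewrite mxip_suml (bigD1 i) //= uN eqxx mulr1 big1 ?addr0 // => j ji.
  by rewrite uN (negbTE ji) mulr0.
rewrite /free size_tuple => /eqP <-.
by apply: leq_trans (dimvS (subvf _)) _; rewrite dimvf.
Qed.

Lemma lin_subspace_sum k (c : 'I_k -> K) (u : 'I_k -> 'M[K]_n) :
  (forall i, S (u i)) -> S (\sum_(i < k) c i *: u i).
Proof.
move=> uS; have [S0 SD SZ] := linS.
by elim/big_ind : _ => // i _; exact: SZ.
Qed.

(** An orthonormal family of maximal size in S spans S, since the normalized
component orthogonal to it of any other vector would extend it; the projection
is then given by the Fourier coefficients. *)
Lemma orth_proj_exists M :
  exists P, S P /\ forall Y, S Y -> mxdot (M - P) Y = 0.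
Proof.
have [S0 SD SZ] := linS.
have ex0 : exists k, `[< orthonormal_in k >].
  exists 0%N; apply/asboolP; exists (fun=> 0); split=> //.
  by case.
have bnd k : `[< orthonormal_in k >] -> (k <= n * n)%N.
  by move=> /asboolP; exact: orthonormal_in_le.
case: (ex_maxnP ex0 bnd) => k /asboolP [u [uS uN]] kmax.
pose pr X := \sum_(i < k) mxip X (u i) *: u i.
have prS X : S (pr X) by exact: lin_subspace_sum.
have prO X i : mxip (X - pr X) (u i) = 0.
  rewrite mxipBl mxip_suml (bigD1 i) //= uN eqxx mulr1 big1 ?addr0 ?subrr //.
  by move=> j ji; rewrite uN (negbTE ji) mulr0.
have prY Y : S Y -> Y = pr Y.
  move=> SY; apply/eqP; rewrite -subr_eq0; apply/negPn/negP => N0.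
  set Z := Y - pr Y in N0.
  have ZO i : mxip Z (u i) = 0 by exact: prO.
  have SZ' : S Z by apply: SD => //; rewrite -scaleN1r; exact: SZ.
  have Zpos : 0 < mxip Z Z by rewrite lt_def mxip_eq0 N0 mxip_ge0.
  pose z := (Num.sqrt (mxip Z Z))^-1.
  have zz : z * (z * mxip Z Z) = 1.
    rewrite mulrA -expr2 /z exprVn sqr_sqrtr ?mxip_ge0 // mulVf //.
    by rewrite gt_eqF.
  suff /kmax : `[< orthonormal_in k.+1 >] by rewrite ltnn.
  apply/asboolP.
  exists (fun i => if unlift ord_max i is Some j then u j else z *: Z); split.
    by move=> i; case: unliftP => [j _|_] //; exact: SZ.
  move=> i j; case: unliftP => [i' ->|->]; case: unliftP => [j' ->|->].
  - by rewrite uN (inj_eq lift_inj).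
  - by rewrite mxipZr mxipC ZO mulr0 eq_sym (negbTE (neq_lift _ _)).
  - by rewrite mxipZl ZO mulr0 (negbTE (neq_lift _ _)).
  - by rewrite mxipZl mxipZr zz eqxx.
exists (pr M); split=> // Y /prY ->.
rewrite -[LHS]/(mxip _ _) mxipC mxip_suml big1 // => i _.
by rewrite [mxip (u i) _]mxipC prO mulr0.
Qed.

Lemma orth_projP M :
  S (orth_proj S M) /\ forall Y, S Y -> mxip (M - orth_proj S M) Y = 0.
Proof. exact: (xgetPex 0 (orth_proj_exists M)).
Qed.

Lemma mxip_orth_proj_l M Y : S Y -> mxip (orth_proj S M) Y = mxip M Y.
Proof.
by move=> SY; have [_ /(_ _ SY)] := orth_projP M; rewrite mxipBl => /eqP;
  rewrite subr_eq0 => /eqP.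
Qed.

Lemma mxip_orth_proj_le M : mxip M (orth_proj S M) <= mxip M M.
Proof.
have [SP _] := orth_projP M; have PM := mxip_orth_proj_l M SP.
have := mxip_ge0 (M - orth_proj S M).
rewrite mxipBl !mxipBr PM (mxipC (orth_proj S M) M) subrr subr0.
by rewrite subr_ge0.
Qed.

End orthogonal_projection.

(** * Linearity of the Lie algebra *)

Section lie_algebra.
Variables (K : realType) (n : nat) (G : set 'M[K]_n).
Hypothesis lieG : matrix_Lie_group G.

Let FF : Filter (0 : K)^'. Proof. exact: dnbhs_filter. Qed.
Let F0 : (0 : K)^' --> (0 : K)^'. Proof. exact: cvg_id. Qed.

Lemma is_derive_has_deriv (f : K -> 'M[K]_n) (t : K) (v : 'M[K]_n) :
  is_derive t (1 : K) f v <-> has_deriv (0 : K)^' f t v.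
Proof.
have E : (fun h => h^-1 *: (f (h *: (1 : K) + t) - f t)) =
         (fun h => h^-1 *: (f (t + h) - f t)).
  by apply/funext => h; rewrite [h *: 1]mulr1 [h + t]addrC.
split=> [[dv <-]|fv].
  by move: dv; rewrite /has_deriv /derivable /derive -E.
by split; rewrite /derivable /derive E; [apply/cvg_ex; exists v | exact/cvg_lim].
Qed.

(** The case k <> 0 of the chain rule for k * t: the increment k * h is
nonzero when h is, so it can be substituted in the difference quotient. *)
Lemma has_deriv_comp_scale (f : K -> 'M[K]_n) (k t : K) (v : 'M[K]_n) : k != 0 ->
  has_deriv (0 : K)^' f (k * t) v ->
  has_deriv (0 : K)^' (fun s => f (k * s)) t (k *: v).
Proof.
move=> k0 fv; rewrite /has_deriv.
have kF : (fun h => k * h) @ (0 : K)^' --> (0 : K)^'.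
  move=> A A0.
  have {}A0 : \forall h \near (0 : K), h != 0 -> A h by exact: A0.
  have kc : (fun h => k * h) @ (0 : K) --> (0 : K).
    have := @mulrl_continuous K k 0; rewrite /continuous_at mulr0; exact.
  suff : \forall h \near (0 : K), h != 0 -> A (k * h) by [].
  have kA0 : \forall h \near (0 : K), k * h != 0 -> A (k * h).
    exact: kc A0.
  apply: filterS kA0 => h /= kA h0.
  by apply: kA; rewrite mulf_neq0.
have kfv : (fun h => k *: ((k * h)^-1 *: (f (k * t + k * h) - f (k * t))))
    @ (0 : K)^' --> k *: v.
  by apply: cvgZ; [exact: cvg_cst | exact: (cvg_comp _ _ kF fv)].
apply: cvg_trans kfv; apply: near_eq_cvg; near=> h => /=.
rewrite -mulrDr scalerA; congr (_ *: _).
by rewrite invfM mulrA mulfV // mul1r.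
Unshelve. all: by end_near. Qed.

(** For curves c and d through the identity, c d has velocity c' + d' there, and
t |-> c(k t) has velocity k c'; both curves remain in G. *)
Lemma Lie_algebra_lin_subspace : lin_subspace (Lie_algebra G).
Proof.
have [_ G1 GM _ _] := lieG.
have S0 : Lie_algebra G 0.
  by exists (fun=> 1%:M); split=> // *; exact: is_derive_cst.
split=> // [A B [c [cG cd c0 cA]] [d [dG dd d0 dB]]|k A [c [cG cd c0 cA]]].
  have cd' (t : K) : has_deriv (0 : K)^' c t ('D_1 c t).
    by apply/is_derive_has_deriv; exact: derivableP.
  have dd' (t : K) : has_deriv (0 : K)^' d t ('D_1 d t).
    by apply/is_derive_has_deriv; exact: derivableP.
  exists (fun t => c t *m d t); split=> [t|t| |].
  - exact: GM.
  - by have /is_derive_has_deriv [] := has_deriv_mulmx FF F0 (cd' t) (dd' t).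
  - by rewrite c0 d0 mul1mx.
  - apply/is_derive_has_deriv.
    have := has_deriv_mulmx FF F0 (proj1 (is_derive_has_deriv _ _ _) cA)
      (proj1 (is_derive_has_deriv _ _ _) dB).
    by rewrite c0 d0 mulmx1 mul1mx.
have [->|k0] := eqVneq k 0; first by rewrite scale0r.
exists (fun t => c (k * t)); split=> [t|t| |].
- exact: cG.
- have /is_derive_has_deriv ck := derivableP (cd (k * t)).
  by have /is_derive_has_deriv [] := has_deriv_comp_scale k0 ck.
- by rewrite mulr0.
- apply/is_derive_has_deriv; apply: has_deriv_comp_scale => //.
  by rewrite mulr0; apply/is_derive_has_deriv.
Qed.

End lie_algebra.

(** * Rayleigh quotients and singular values *)

Section rayleigh.
Variables (K : realType) (n : nat).

(** The quadratic form of B vanishes at c and is nonnegative at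
(d + 1) c - a c B, where a = |c B|^2 and d is the value of the form at c B.
Its value there is - a^2 (d + 2), which forces a = 0. *)
Lemma psd_kernel (B : 'M[K]_n) (c : 'rV[K]_n) : B^T = B ->
  (forall v : 'rV[K]_n, 0 <= mxip v (v *m B)) -> mxip c (c *m B) = 0 ->
  c *m B = 0.
Proof.
move=> symB psd cB0; set u := c *m B.
apply/eqP; rewrite -mxip_eq0; apply/negPn/negP => N0.
have a0 : 0 < mxip u u by rewrite lt_def N0 mxip_ge0.
set a := mxip u u in a0; pose d := mxip u (u *m B).
have d0 : 0 <= d := psd u.
have cuB : mxip c (u *m B) = a.
  rewrite /a /mxip /u -(mxtrace_mulC _ (c *m B)^T) -(mxtrace_mulC _ c^T).
  by rewrite trmx_mul symB -!mulmxA.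
have := psd ((d + 1) *: c - a *: u).
rewrite mulmxBl -!scalemxAl !(mxipBl, mxipBr, mxipZl, mxipZr) cB0 cuB -/u -/a -/d.
move=> H.
have : 0 <= - (a ^+ 2 * (d + 2)).
  by apply: le_trans H _; rewrite le_eqVlt; apply/orP; left; apply/eqP; ring.
rewrite oppr_ge0 pmulr_rle0 ?exprn_gt0 // => d2.
by move: d2 d0; lra.
Qed.

(** The quadratic form of S attains its maximum m on the compact unit sphere,
and the maximizer c lies in the kernel of the positive semidefinite m - S. *)
Lemma max_eigenvalue (S : 'M[K]_n) : (0 < n)%N -> S^T = S ->
  exists m, eigenvalue S m /\
    forall v : 'rV[K]_n, mxip v (v *m S) <= m * mxip v v.
Proof.
move=> n0 symS.
pose sphere := [set v : 'rV[K]_n | mxip v v = 1].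
pose q (v : 'rV[K]_n) : K := mxip v (v *m S).
have cont (T : 'M[K]_n) : continuous (fun v : 'rV[K]_n => mxip v (v *m T) : K).
  move=> v; have FF : Filter (nbhs v) := nbhs_filter v.
  have vid : (fun u : 'rV[K]_n => u) @ nbhs v --> v by exact: cvg_id.
  apply: (cvg_mxtrace FF (f := fun u => u^T *m (u *m T))).
  apply: (cvg_mulmx FF); first exact: cvg_trmx.
  by apply: (cvg_mulmx FF) => //; exact: cvg_cst.
have compS : compact sphere.
  apply: bounded_closed_compact.
    exists 1; split=> // M M1 v /= v1.
    rewrite /Num.Def.normr /= mx_normrE bigmax_le //=.
      by rewrite (le_trans ler01) // ltW.
    move=> [i j] _ /=; apply: le_trans (ltW M1).
    rewrite -(@ler_pXn2r _ 2) ?nnegrE ?normr_ge0 // expr1n real_normK ?num_real //.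
    by rewrite -v1 sqr_coord_le.
  have -> : sphere = (fun v : 'rV[K]_n => mxip v (v *m 1%:M) : K) @^-1` [set 1].
    by apply/seteqP; split=> v /=; rewrite mulmx1.
  by apply: closed_comp => [x _|]; [exact: cont | exact: closed_eq].
have nonempty : sphere !=set0.
  exists (delta_mx 0 (Ordinal n0)); rewrite /sphere /= mxipE big_ord1.
  rewrite (bigD1 (Ordinal n0)) //= !mxE !eqxx mulr1 big1 ?addr0 // => j ji.
  by rewrite !mxE eqxx (negbTE ji) mulr0.
have [|c /set_mem cS cmax] :=
    EVT_max_rV nonempty compS (f := q) .
  by apply: continuous_subspaceT; exact: cont.
pose m := q c.
have mP v : q v <= m * mxip v v.
  have [->|v0] := eqVneq v 0; first by
    rewrite /q /mxip !trmx0 !mul0mx !linear0 mulr0.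
  have vpos : 0 < mxip v v by rewrite lt_def mxip_eq0 v0 mxip_ge0.
  pose z := (Num.sqrt (mxip v v))^-1.
  have zz : z * z = (mxip v v)^-1 by rewrite -expr2 /z exprVn sqr_sqrtr ?mxip_ge0.
  have : q (z *: v) <= m.
    apply: cmax; apply: mem_set; rewrite /sphere /= mxipZl mxipZr mulrA zz mulVf //.
    by rewrite gt_eqF.
  rewrite /q -scalemxAl mxipZl mxipZr mulrA zz.
  by rewrite mulrC ler_pdivrMr.
exists m; split=> //; apply/eigenvalueP; exists c; last first.
  apply/eqP => c0; move: cS; rewrite /sphere /= c0 /mxip trmx0 mul0mx linear0.
  by move/eqP; rewrite eq_sym oner_eq0.
apply/eqP; rewrite eq_sym -subr_eq0 -mul_mx_scalar -mulmxBr; apply/eqP.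
apply: psd_kernel => [|v|].
- by rewrite linearB /= symS tr_scalar_mx.
- by rewrite mulmxBr mul_mx_scalar mxipBr mxipZr subr_ge0; exact: mP.
- by rewrite mulmxBr mul_mx_scalar mxipBr mxipZr cS mulr1 subrr.
Qed.

End rayleigh.
Section singular_value_bounds.
Variables (K : realType) (n : nat).

Lemma mxip_gram (g : 'M[K]_n) (v : 'rV[K]_n) :
  mxip v (v *m (g^T *m g)) = mxip (v *m g^T) (v *m g^T).
Proof.
by rewrite /mxip trmx_mul trmxK !mulmxA [LHS]mxtrace_mulC !mulmxA.
Qed.

Lemma eigenvalue_mxip (S : 'M[K]_n) a : eigenvalue S a ->
  exists v : 'rV[K]_n, 0 < mxip v v /\ mxip v (v *m S) = a * mxip v v.
Proof.
move=> /eigenvalueP[v vS v0]; exists v; rewrite vS mxipZr; split=> //.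
by rewrite lt_def mxip_eq0 v0 mxip_ge0.
Qed.

Lemma eigenvalue_gram_ge0 (g : 'M[K]_n) a : eigenvalue (g^T *m g) a -> 0 <= a.
Proof.
move=> /eigenvalue_mxip[v [v0 va]].
by rewrite -(pmulr_lge0 _ v0) -va mxip_gram mxip_ge0.
Qed.

Lemma sigma_max_mxip_le (g : 'M[K]_n) U : (0 < n)%N -> sigma_max g <= U ->
  forall v : 'rV[K]_n, mxip (v *m g^T) (v *m g^T) <= U ^+ 2 * mxip v v.
Proof.
move=> n0 gU v.
have [|m [mE mP]] := @max_eigenvalue K n (g^T *m g) n0.
  by rewrite trmx_mul trmxK.
have m0 := eigenvalue_gram_ge0 mE.
have mU : Num.sqrt m <= U.
  apply: le_trans gU; apply: ub_le_sup.
    exists (Num.sqrt m) => s [s0 /eigenvalue_mxip[u [u0 us]]].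
    rewrite -(ger0_norm s0) -sqrtr_sqr.
    by rewrite ler_sqrt // -(ler_pM2r u0) -us mP.
  by split; [exact: sqrtr_ge0 | rewrite sqr_sqrtr].
rewrite -mxip_gram; apply: le_trans (mP v) _.
apply: ler_wpM2r; first exact: mxip_ge0.
rewrite -(sqr_sqrtr m0) ler_pXn2r ?nnegrE ?sqrtr_ge0 //.
exact: le_trans (sqrtr_ge0 m) mU.
Qed.

(** The smallest eigenvalue of g^T g is minus the largest one of - g^T g. *)
Lemma sigma_min_mxip_ge (g : 'M[K]_n) L : (0 < n)%N -> 0 <= L ->
  L <= sigma_min g ->
  forall v : 'rV[K]_n, L ^+ 2 * mxip v v <= mxip (v *m g^T) (v *m g^T).
Proof.
move=> n0 L0 gL v.
have [|m [mE mP]] := @max_eigenvalue K n (- (g^T *m g)) n0.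
  by rewrite linearN /= trmx_mul trmxK.
have {}mE : eigenvalue (g^T *m g) (- m).
  case/eigenvalueP: mE => u uS u0; apply/eigenvalueP; exists u => //.
  by rewrite scaleNr -uS mulmxN opprK.
have m0 := eigenvalue_gram_ge0 mE.
have mL : L <= Num.sqrt (- m).
  apply: le_trans gL _; apply: ge_inf.
    by exists 0 => s [].
  by split; [exact: sqrtr_ge0 | rewrite sqr_sqrtr].
rewrite -mxip_gram -lerN2; have := mP v; rewrite mulmxN mxipNr => /le_trans; apply.
rewrite -mulNr; apply: ler_wpM2r; first exact: mxip_ge0.
rewrite lerNr -(sqr_sqrtr m0) ler_pXn2r ?nnegrE ?sqrtr_ge0 //.
Qed.

(** The rows of A are the images of the n unit vectors. *)
Lemma mxip_le_of_rows (A : 'M[K]_n) c :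
  (forall v : 'rV[K]_n, mxip (v *m A) (v *m A) <= c * mxip v v) ->
  mxip A A <= n%:R * c.
Proof.
move=> Ac; rewrite mxipE mulr_natl -[n in c *+ n]card_ord -sumr_const.
apply: ler_sum => i _.
have := Ac (delta_mx 0 i).
have -> : mxip (delta_mx 0 i) (delta_mx 0 i : 'rV[K]_n) = 1.
  rewrite mxipE big_ord1 (bigD1 i) //= !mxE !eqxx mulr1 big1 ?addr0 // => j ji.
  by rewrite !mxE eqxx (negbTE ji) mulr0.
rewrite mulr1 -rowE mxipE big_ord1; apply: le_trans.
by under [X in _ <= X]eq_bigr do rewrite !mxE.
Qed.

Lemma frobenius_sigma_max_le (g : 'M[K]_n) U : (0 < n)%N -> 0 <= U ->
  sigma_max g <= U -> frobenius g <= Num.sqrt n%:R * U.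
Proof.
move=> n0 U0 gU.
rewrite -(@ler_pXn2r _ 2) ?nnegrE ?mulr_ge0 ?frobenius_ge0 ?sqrtr_ge0 //.
rewrite exprMn sqr_frobenius sqr_sqrtr ?ler0n // -mxip_tr.
by apply: mxip_le_of_rows; exact: sigma_max_mxip_le.
Qed.

Lemma frobenius_sigma_min_le (g : 'M[K]_n) L : (0 < n)%N -> g \in unitmx ->
  0 < L -> L <= sigma_min g -> frobenius (invmx g) <= Num.sqrt n%:R / L.
Proof.
move=> n0 gU L0 gL.
rewrite -(@ler_pXn2r _ 2) ?nnegrE ?mulr_ge0 ?invr_ge0 ?frobenius_ge0 ?sqrtr_ge0 //;
  last exact: ltW.
rewrite exprMn sqr_frobenius sqr_sqrtr ?ler0n // -mxip_tr trmx_inv.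
apply: mxip_le_of_rows => v.
have := sigma_min_mxip_ge n0 (ltW L0) gL (v *m invmx g^T).
rewrite mulmxKV ?unitmx_tr // exprVn mulrC => H.
by rewrite ler_pdivlMl ?exprn_gt0 // mulrC.
Qed.

End singular_value_bounds.

(** * The Lyapunov function of the error system *)

(** Here x, y and z stand for |u|, |e| and <u, e>, and W for the Lyapunov
function; the last inequality has on its left the bound for W' obtained from
the error system. *)
Lemma lyapunov_constants (K : realType) (al k kI : K) :
  0 < al -> 0 < kI ->
  exists d c1 c2 r : K, [/\ 0 < c1, 0 < c2, 0 < r &
    forall x y z : K, `|z| <= x * y ->
    let W := 2^-1 * x ^+ 2 + (2 * kI)^-1 * y ^+ 2 + d * z in
    [/\ c1 * (x ^+ 2 + y ^+ 2) <= W, W <= c2 * (x ^+ 2 + y ^+ 2), 0 <= d &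
      - al * x ^+ 2 + d * (k * (x * y) - y ^+ 2 + kI * x ^+ 2) <= - r * W]].
Proof.
move=> al0 kI0.
(* The summands of N make d = 1 / N satisfy d <= 1/2 and d <= 1 / (2 kI),
   so that the cross term is dominated, and d (k^2 + 2 kI) <= al and d <= al, so
   that the dissipation of x^2 absorbs the mixed terms. *)
pose N := 2 + 2 * kI + (k ^+ 2 + 2 * kI + 1) / al.
have k2 : 0 <= k ^+ 2 by exact: sqr_ge0.
have N0 : 0 < N.
  rewrite /N; apply: addr_gt0; first lra.
  by apply: divr_gt0 => //; lra.
pose d := N^-1.
have d0 : 0 < d by rewrite invr_gt0.
have dN : d * (2 + 2 * kI) + d * (k ^+ 2 + 2 * kI + 1) / al = 1.
  by rewrite -mulrA -mulrDr mulVf // gt_eqF.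
have p1 : 0 <= d * (k ^+ 2 + 2 * kI + 1) / al.
  by rewrite !mulr_ge0 ?invr_ge0 ?(ltW al0) ?(ltW d0) //; lra.
have dkI : 0 < d * kI by rewrite mulr_gt0.
have dle2 : d * 2 <= 1 by lra.
have dlekI : d * (2 * kI) <= 1 by lra.
have p2 : d * (k ^+ 2 + 2 * kI + 1) <= al.
  by rewrite -[leRHS]mul1r -ler_pdivrMr //; lra.
have dk2 : 0 <= d * k ^+ 2 by rewrite mulr_ge0 // ltW.
have dal : d <= al by lra.
have dkal : d * (k ^+ 2 + 2 * kI) <= al by lra.
pose i := (2 * kI)^-1.
have i0 : 0 < i by rewrite invr_gt0 mulr_gt0.
have di : d <= i by rewrite -[i]div1r ler_pdivlMr ?mulr_gt0.
exists d, (d / 2), (1 + i + d), (d / 2 / (1 + i + d)).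
have c20 : 0 < 1 + i + d by lra.
have d20 : 0 < d / 2 by lra.
split=> //; first by rewrite divr_gt0.
move=> x y z; rewrite ler_norml => /andP[z1 z2]; rewrite -/i.
have x2 : 0 <= x ^+ 2 by exact: sqr_ge0.
have y2 : 0 <= y ^+ 2 by exact: sqr_ge0.
have xy : 2 * (x * y) <= x ^+ 2 + y ^+ 2.
  by have := sqr_ge0 (x - y); rewrite sqrrB -mulr_natl; lra.
have dz1 : d * - (x * y) <= d * z by rewrite ler_pM2l.
have dz2 : d * z <= d * (x * y) by rewrite ler_pM2l.
have dxy : d * (2 * (x * y)) <= d * (x ^+ 2 + y ^+ 2) by rewrite ler_pM2l.
have dx : d * x ^+ 2 <= 2^-1 * x ^+ 2 by apply: ler_wpM2r => //; lra.
have dy : d * y ^+ 2 <= i * y ^+ 2 by apply: ler_wpM2r.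
have ix : 0 <= i * x ^+ 2 by rewrite mulr_ge0 // ltW.
have dx0 : 0 <= d * x ^+ 2 by rewrite mulr_ge0 // ltW.
have dy0 : 0 <= d * y ^+ 2 by rewrite mulr_ge0 // ltW.
set W := _ + _ + d * z.
have Wup : W <= (1 + i + d) * (x ^+ 2 + y ^+ 2) by rewrite /W; lra.
split=> //; first by rewrite /W; lra.
  exact: ltW.
have kxy : 2 * (k * (x * y)) <= k ^+ 2 * x ^+ 2 + y ^+ 2.
  have -> : k ^+ 2 * x ^+ 2 + y ^+ 2 =
      (k * x - y) ^+ 2 + 2 * (k * (x * y)) by ring.
  by rewrite lerDr sqr_ge0.
have dkxy : d * (2 * (k * (x * y))) <= d * (k ^+ 2 * x ^+ 2 + y ^+ 2).
  by rewrite ler_pM2l.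
have dkx : d * (k ^+ 2 + 2 * kI + 1) * x ^+ 2 <= al * x ^+ 2.
  by apply: ler_wpM2r.
have alx : d * x ^+ 2 <= al * x ^+ 2 by apply: ler_wpM2r.
apply: (@le_trans _ _ (- (d / 2) * (x ^+ 2 + y ^+ 2))); first by lra.
rewrite [leLHS]mulNr [leRHS]mulNr lerN2 mulrAC ler_pdivrMr //.
rewrite -[leRHS]mulrA ler_pM2l //.
by rewrite [leRHS]mulrC.
Qed.
Section error_system.
Variables (K : realType) (n : nat).

Definition error_energy (u e : 'M[K]_n) : K := frobenius u ^+ 2 + frobenius e ^+ 2.

(** The three trilinear terms are each bounded by Cauchy-Schwarz; the two that
contain w do not cancel, whence the factor 2. *)
Lemma mxip_deriv_self_le (u e w b : 'M[K]_n) (Bw Bb k : K) : 0 <= k ->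
  frobenius w <= Bw -> frobenius b <= Bb ->
  mxip u (- (w *m u) + u *m (w + b) - e - k *: u) <=
    - (k - 2 * Bw - Bb) * frobenius u ^+ 2 - mxip u e.
Proof.
move=> k0 wB bB.
rewrite mulmxDr !(mxipDr, mxipNr, mxipZr) -sqr_frobenius.
have x0 := frobenius_ge0 u.
have xx : 0 <= frobenius u * frobenius u by rewrite mulr_ge0.
have h1 := mxip_mulmx_abs u w u; have h2 := mxip_mulmx_abs u u w.
have h3 := mxip_mulmx_abs u u b.
have w1 : frobenius u * (frobenius w * frobenius u) <=
    frobenius u * frobenius u * Bw.
  by rewrite mulrCA mulrC ler_wpM2l.
have b1 : frobenius u * (frobenius u * frobenius b) <=
    frobenius u * frobenius u * Bb.
  by rewrite mulrA ler_wpM2l.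
have w2 : frobenius u * (frobenius u * frobenius w) <=
    frobenius u * frobenius u * Bw.
  by rewrite mulrA ler_wpM2l.
move: h1 h2 h3; rewrite !ler_norml => /andP[h1 _] /andP[_ h2] /andP[_ h3].
rewrite expr2; lra.
Qed.

Lemma mxip_deriv_cross_le (u e w b : 'M[K]_n) (Bw Bb k : K) : 0 <= k ->
  frobenius w <= Bw -> frobenius b <= Bb ->
  mxip (- (w *m u) + u *m (w + b) - e - k *: u) e <=
    (2 * Bw + Bb + k) * (frobenius u * frobenius e) - frobenius e ^+ 2.
Proof.
move=> k0 wB bB; rewrite mxipC.
rewrite mulmxDr !(mxipDr, mxipNr, mxipZr) -sqr_frobenius.
have x0 := frobenius_ge0 u; have y0 := frobenius_ge0 e.
have xy : 0 <= frobenius u * frobenius e by rewrite mulr_ge0.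
have h1 := mxip_mulmx_abs e w u; have h2 := mxip_mulmx_abs e u w.
have h3 := mxip_mulmx_abs e u b; have h4 := mxip_le e u.
have w1 : frobenius e * (frobenius w * frobenius u) <=
    frobenius u * frobenius e * Bw.
  by rewrite mulrCA mulrC (mulrC (frobenius e)) ler_wpM2l.
have b1 : frobenius e * (frobenius u * frobenius b) <=
    frobenius u * frobenius e * Bb.
  by rewrite mulrA (mulrC (frobenius e)) ler_wpM2l.
have w2 : frobenius e * (frobenius u * frobenius w) <=
    frobenius u * frobenius e * Bw.
  by rewrite mulrA (mulrC (frobenius e)) ler_wpM2l.
have k1 : k * - mxip e u <= k * (frobenius u * frobenius e).
  by rewrite ler_wpM2l // mulrC lerNl; move: h4; rewrite ler_norml => /andP[].
move: h1 h2 h3; rewrite !ler_norml => /andP[h1 _] /andP[_ h2] /andP[_ h3].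
lra.
Qed.

(** The constants r and D are chosen before the trajectory, which makes the
decay uniform in the initial condition. *)
Lemma error_energy_decay (S : set 'M[K]_n) (Bw Bb k kI : K) : lin_subspace S ->
  0 <= k -> 2 * Bw + Bb < k -> 0 < kI ->
  exists r D : K, [/\ 0 < r, 0 < D &
    forall (w u e : K -> 'M[K]_n) (b : 'M[K]_n),
      frobenius b <= Bb ->
      (forall t, 0 <= t -> frobenius (w t) <= Bw) ->
      (forall t, 0 <= t -> S (e t)) ->
      (forall t, 0 <= t -> has_deriv (nneg_increments t) u t
        (- (w t *m u t) + u t *m (w t + b) - e t - k *: u t)) ->
      (forall t, 0 <= t -> has_deriv (nneg_increments t) e t
        (kI *: orth_proj S (u t))) ->
      forall t, 0 <= t -> error_energy (u t) (e t) <=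
        D * error_energy (u 0) (e 0) * expR (- r * t)].
Proof.
move=> linS k0 kB kI0.
have al0 : 0 < k - 2 * Bw - Bb by lra.
have [d [c1 [c2 [r [c10 c20 r0 cst]]]]] :=
  lyapunov_constants (2 * Bw + Bb + k) al0 kI0.
exists r, (c2 / c1); split=> //; first by rewrite divr_gt0.
move=> w u e b bB wB eS u' e' t t0.
pose W s := 2^-1 * mxip (u s) (u s) + (2 * kI)^-1 * mxip (e s) (e s)
  + d * mxip (u s) (e s).
have Wcst s := cst _ _ _ (mxip_le (u s) (e s)).
pose du s : 'M[K]_n := - (w s *m u s) + u s *m (w s + b) - e s - k *: u s.
pose de s : 'M[K]_n := kI *: orth_proj S (u s).
pose dW s := 2^-1 * (mxip (du s) (u s) + mxip (u s) (du s)) +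
  (2 * kI)^-1 * (mxip (de s) (e s) + mxip (e s) (de s)) +
  d * (mxip (du s) (e s) + mxip (u s) (de s)).
have W' (s : K) : 0 <= s -> has_deriv (nneg_increments s) (W : K -> K^o) s (dW s).
  move=> s0; have FF := nneg_increments_filter s.
  have F0 := @nneg_increments_dnbhs K s.
  have us := u' s s0; have es := e' s s0.
  have h1 := has_derivZ FF (V := K^o) (k := 2^-1) (has_deriv_mxdot FF F0 us us).
  have h2 := has_derivZ FF (V := K^o) (k := (2 * kI)^-1) (has_deriv_mxdot FF F0 es es).
  have h3 := has_derivZ FF (V := K^o) (k := d) (has_deriv_mxdot FF F0 us es).
  exact: (has_derivD FF (has_derivD FF h1 h2) h3).
have dW_le (s : K) : 0 <= s -> dW s <= - r * W s.
  move=> s0; have [_ _ d0 Ws] := Wcst s.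
  rewrite !sqr_frobenius -/(W s) in Ws; apply: le_trans _ Ws.
  have h1 := mxip_deriv_self_le (u s) (e s) k0 (wB s s0) bB.
  have h2 := mxip_deriv_cross_le (u s) (e s) k0 (wB s s0) bB.
  (* Divided by kI, this cancels the term - <u, e> in the derivative of
     |u|^2 / 2. *)
  have ue : mxip (e s) (de s) = kI * mxip (u s) (e s).
    by rewrite mxipZr mxipC (mxip_orth_proj_l linS _ (eS s s0)).
  have uu : mxip (u s) (de s) <= kI * mxip (u s) (u s).
    by rewrite mxipZr ler_pM2l // (mxip_orth_proj_le linS).
  rewrite -/(du s) sqr_frobenius in h1; rewrite -/(du s) sqr_frobenius in h2.
  have h3 := ler_wpM2l d0 (lerD h2 uu).
  rewrite /dW (mxipC (de s)) (mxipC (du s) (u s)) ue.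
  have -> : (2 * kI)^-1 * (kI * mxip (u s) (e s) + kI * mxip (u s) (e s)) =
      mxip (u s) (e s) by field; rewrite gt_eqF.
  lra.
have [l0 _ _ _] := Wcst t; have [_ u0 _ _] := Wcst 0.
rewrite !sqr_frobenius -/(W _) in l0 u0.
rewrite /error_energy !sqr_frobenius.
rewrite -(ler_pM2l c10); apply: (le_trans l0).
apply: (le_trans (exp_decay W' dW_le t0)).
have -> : c1 * (c2 / c1 * (mxip (u 0) (u 0) + mxip (e 0) (e 0)) * expR (- r * t)) =
  c2 * (mxip (u 0) (u 0) + mxip (e 0) (e 0)) * expR (- r * t).
  by field; rewrite gt_eqF.
by rewrite ler_pM2r ?expR_gt0.
Qed.

End error_system.

(** * Exponential convergence of the observer *)

(** With Abar = A (1 - u), the observer term A^-1 Abar (w + b) equals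
(1 - u) (w + b); the w of its part w + b cancels A^-1 A' = w, and the
remaining - b combines with b - e to - e. *)
Lemma relative_error_has_deriv (K : realType) (n : nat) (t k : K)
    (A Abar : K -> 'M[K]_n) (w b e : 'M[K]_n) :
  (forall s, A s \in unitmx) ->
  has_deriv (nneg_increments t) A t (A t *m w) ->
  has_deriv (nneg_increments t) Abar t
    (Abar t *m (w + b) - A t *m (b - e) + k *: (A t - Abar t)) ->
  let u s := invmx (A s) *m (A s - Abar s) in
  has_deriv (nneg_increments t) u t
    (- (w *m u t) + u t *m (w + b) - e - k *: u t).
Proof.
move=> Aunit A' Abar' u; have FF := nneg_increments_filter t.
have F0 := @nneg_increments_dnbhs K t.
have := has_deriv_mulmx FF F0 (has_deriv_invmx FF F0 Aunit A')
  (has_derivB FF A' Abar').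
congr (has_deriv _ _ _ _).
have wA : invmx (A t) *m (A t *m w) = w by exact: mulKmx.
pose Z := invmx (A t) *m Abar t.
have uE : u t = 1%:M - Z by rewrite /u mulmxBr mulVmx.
have ZE : Z = 1%:M - u t by rewrite uE subKr.
have kE : invmx (A t) *m (k *: (A t - Abar t)) = k *: u t by rewrite -scalemxAr.
have key : invmx (A t) *m (A t *m w -
    (Abar t *m (w + b) - A t *m (b - e) + k *: (A t - Abar t))) =
    u t *m (w + b) - e - k *: u t.
  rewrite mulmxBr wA mulmxDr [invmx (A t) *m (_ - _)]mulmxBr mulmxA -/Z mulKmx //.
  rewrite kE ZE mulmxBl mul1mx.
  move: (u t *m (w + b)) (u t) => V U.
  by apply/matrixP => i j; rewrite !mxE; ring.
by rewrite wA mulNmx -mulmxA -/(u t) key !addrA.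
Qed.

Lemma invmxM (K : realType) (n : nat) (A B : 'M[K]_n) :
  A \in unitmx -> B \in unitmx -> invmx (A *m B) = invmx B *m invmx A.
Proof.
move=> Au Bu; have ABu : A *m B \in unitmx by rewrite unitmx_mul Au.
by rewrite -[RHS](mulKmx ABu) -(mulmxA A) mulKVmx // mulmxV // mulmx1.
Qed.

Lemma frobenius_invmx_mul_le (K : realType) (n : nat) (A E : 'M[K]_n) M :
  frobenius (invmx A) <= M -> frobenius (invmx A *m E) <= M * frobenius E.
Proof.
move=> AM; apply: le_trans (frobenius_mulmx _ _) _.
by apply: ler_wpM2r => //; exact: frobenius_ge0.
Qed.

Lemma frobenius_le_invmx_mul (K : realType) (n : nat) (A E : 'M[K]_n) M :
  A \in unitmx -> frobenius A <= M ->
  frobenius E <= M * frobenius (invmx A *m E).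
Proof.
move=> Au AM; rewrite -{1}(mulKVmx Au E).
apply: le_trans (frobenius_mulmx _ _) _.
by apply: ler_wpM2r => //; exact: frobenius_ge0.
Qed.

(** Square roots of both sides, using (x + y)^2 <= 2 (x^2 + y^2). *)
Lemma energy_decay_norm_decay (K : realType) (x0 y0 x y D E : K) :
  0 <= x0 -> 0 <= y0 -> 0 <= x -> 0 <= y -> 0 <= D -> 0 <= E ->
  x ^+ 2 + y ^+ 2 <= D * (x0 ^+ 2 + y0 ^+ 2) * E ^+ 2 ->
  x + y <= Num.sqrt (2 * D) * (x0 + y0) * E.
Proof.
move=> x00 y00 x1 y1 D0 E0 H.
rewrite -(@ler_pXn2r _ 2) ?nnegrE ?mulr_ge0 ?addr_ge0 ?sqrtr_ge0 //.
rewrite !exprMn sqr_sqrtr ?mulr_ge0 //.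
have le1 : (x + y) ^+ 2 <= 2 * (x ^+ 2 + y ^+ 2).
  by have := sqr_ge0 (x - y); rewrite !expr2; lra.
have le2 : D * (x0 ^+ 2 + y0 ^+ 2) * E ^+ 2 <= D * (x0 + y0) ^+ 2 * E ^+ 2.
  rewrite ler_wpM2r ?sqr_ge0 // ler_wpM2l //.
  by have := mulr_ge0 x00 y00; rewrite !expr2; lra.
lra.
Qed.

Theorem mainTheorem4 (R : realType) (n : nat) (hn : (0 < n)%N)
    (G : set 'M[R]_n) (hG : matrix_Lie_group G)
    (g xi : R -> 'M[R]_n) (htraj : is_trajectory G g xi)
    (F : 'M[R]_n) (hF : F \in unitmx)
    (A : R -> 'M[R]_n) (hA : forall t : R, 0 <= t -> A t = F *m g t)
    (b : 'M[R]_n) (hb : Lie_algebra G b)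
    (xim : R -> 'M[R]_n) (hxim : forall t : R, 0 <= t -> xim t = xi t + b)
    (Bxi Bb : R) (hBxi : 0 < Bxi) (hBb : 0 < Bb)
    (hxi_bound : forall t : R, 0 <= t -> frobenius (xi t) <= Bxi)
    (hb_bound : frobenius b <= Bb)
    (Lg Ug : R) (hLg : 0 < Lg) (hUg : 0 < Ug)
    (hg_bound : forall t : R, 0 <= t ->
       [/\ Lg <= sigma_min (g t),
           sigma_min (g t) <= sigma_max (g t) &
           sigma_max (g t) <= Ug])
    (kP kI : R) (hkP : 2 * Bxi + Bb < kP) (hkI : 0 < kI) :
  exists a C : R, [/\ 0 < a, 0 < C &
    forall Abar bbar : R -> 'M[R]_n,
      is_observer_trajectory G kP kI A xim Abar bbar ->
      forall t : R, 0 <= t ->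
        frobenius (A t - Abar t) + frobenius (b - bbar t) <=
        C * (frobenius (A 0 - Abar 0) + frobenius (b - bbar 0))
          * expR (- a * t)].
Proof.
have linS := Lie_algebra_lin_subspace hG.
have kP0 : 0 <= kP by lra.
have [r [D [r0 D0 decay]]] := error_energy_decay linS kP0 hkP hkI.
(* M bounds A and N its inverse; the summand 1 makes both constants at least 1,
   so that the error e, which is not rescaled, obeys the same estimates. *)
pose M := 1 + frobenius F * (Num.sqrt n%:R * Ug).
pose N := 1 + Num.sqrt n%:R / Lg * frobenius (invmx F).
have sqn : 0 <= Num.sqrt (n%:R : R) by exact: sqrtr_ge0.
have M0 : 0 <= frobenius F * (Num.sqrt n%:R * Ug).
  by rewrite !mulr_ge0 ?frobenius_ge0 // ltW.
have N0 : 0 <= Num.sqrt n%:R / Lg * frobenius (invmx F).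
  by rewrite !mulr_ge0 ?frobenius_ge0 ?invr_ge0 // ltW.
(* The derivative of the inverse is taken along a curve of units defined at
   every real time, and the values of A at negative times are arbitrary. *)
pose A1 (t : R) := F *m g (Num.max 0 t).
have gunit t : g (Num.max 0 t) \in unitmx.
  have t0 : 0 <= Num.max 0 t by rewrite le_max lexx.
  by have [Gu _ _ _ _] := hG; have [/Gu] := htraj _ t0.
have A1unit t : A1 t \in unitmx by rewrite unitmx_mul hF gunit.
have A1E t : 0 <= t -> A1 t = A t.
  by move=> t0; rewrite /A1 hA //; congr (F *m g _); exact/max_idPr.
have A1_le t : 0 <= t -> frobenius (A1 t) <= M.
  move=> t0; rewrite A1E // hA //; apply: le_trans (frobenius_mulmx _ _) _.
  apply: (@le_trans _ _ (frobenius F * (Num.sqrt n%:R * Ug)));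
    last by rewrite /M; lra.
  apply: ler_wpM2l; first exact: frobenius_ge0.
  have [_ _ gU] := hg_bound t t0.
  by apply: frobenius_sigma_max_le => //; exact: ltW.
have A1V_le t : 0 <= t -> frobenius (invmx (A1 t)) <= N.
  move=> t0; rewrite /A1 (invmxM hF (gunit t)).
  apply: le_trans (frobenius_mulmx _ _) _.
  apply: (@le_trans _ _ (Num.sqrt n%:R / Lg * frobenius (invmx F)));
    last by rewrite /N; lra.
  apply: ler_wpM2r; first exact: frobenius_ge0.
  apply: frobenius_sigma_min_le => //.
  have t1 : 0 <= Num.max 0 t by rewrite le_max lexx.
  by have [] := hg_bound _ t1.
have MN0 : 0 < M * (Num.sqrt (2 * D) * N).
  rewrite !mulr_gt0 ?sqrtr_gt0 ?mulr_gt0 //; rewrite /M /N; lra.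
exists (r / 2), (M * (Num.sqrt (2 * D) * N)).
split=> //; first by rewrite divr_gt0.
move=> Abar bbar obs t t0.
pose u s := invmx (A1 s) *m (A1 s - Abar s).
pose e s := b - bbar s.
have A1' s : 0 <= s -> has_deriv (nneg_increments s) A1 s (A1 s *m xi s).
  move=> s0; have [_ _ gs] := htraj s s0.
  have FF := nneg_increments_filter s.
  have := has_deriv_mulmx FF (@nneg_increments_dnbhs R s)
    (has_deriv_cst FF F s) gs.
  rewrite mul0mx add0r mulmxA -hA // -A1E //.
  by apply: eq_has_deriv_nneg => // q q0; rewrite A1E // hA.
have u' s : 0 <= s -> has_deriv (nneg_increments s) u s
    (- (xi s *m u s) + u s *m (xi s + b) - e s - kP *: u s).
  move=> s0; apply: relative_error_has_deriv => //; first exact: A1'.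
  have [_ + _] := obs s s0; rewrite hxim // -A1E //.
  by rewrite /e subKr.
have e' s : 0 <= s -> has_deriv (nneg_increments s) e s
    (kI *: orth_proj (Lie_algebra G) (u s)).
  move=> s0; have FF := nneg_increments_filter s.
  have [_ _ +] := obs s s0; rewrite -A1E // -/(u s) => bs.
  have := has_derivB FF (has_deriv_cst FF b s) bs.
  by rewrite scaleNr opprK add0r.
have eS s : 0 <= s -> Lie_algebra G (e s).
  move=> s0; have [bS _ _] := obs s s0; have [_ SD SZ] := linS.
  by apply: SD => //; rewrite -scaleN1r; exact: SZ.
have := decay xi u e b hb_bound hxi_bound eS u' e' t t0.
have -> : expR (- r * t) = expR (- (r / 2) * t) ^+ 2.
  by rewrite expr2 -expRD; congr expR; field.
rewrite /error_energy => /energy_decay_norm_decay H.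
have {}H := H (frobenius_ge0 _) (frobenius_ge0 _) (frobenius_ge0 _)
  (frobenius_ge0 _) (ltW D0) (expR_ge0 _).
have Et : frobenius (A t - Abar t) <= M * frobenius (u t).
  by rewrite -A1E //; apply: frobenius_le_invmx_mul => //; exact: A1_le.
have E0 : frobenius (u 0) <= N * frobenius (A 0 - Abar 0).
  by rewrite -A1E //; apply: frobenius_invmx_mul_le; exact: A1V_le.
have et : frobenius (e t) <= M * frobenius (e t).
  by rewrite ler_peMl ?frobenius_ge0 // /M; lra.
have e0 : frobenius (e 0) <= N * frobenius (e 0).
  by rewrite ler_peMl ?frobenius_ge0 // /N; lra.
apply: le_trans (lerD Et et) _; rewrite -mulrDr -!mulrA ler_wpM2l //.
  by rewrite /M; lra.
apply: le_trans H _; rewrite -!mulrA ler_wpM2l ?sqrtr_ge0 // !mulrA.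
by rewrite ler_wpM2r ?expR_ge0 // mulrDr lerD.
Qed.
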